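(* Let $\Omega=(a,b)$ with real numbers $a<b$. For all grid sizes $h$ and each $p\in\mathbb{N}$ with $2hp<|\Omega|$, there is a non-constant function $u_{p,h}\in\widetilde{S}_{p,h}(\Omega)$ such that $$|u_{p,h}|_{H^1(\Omega)}\ge\frac{1}{2\sqrt{2}}\,h^{-1}\,\|u_{p,h}\|_{L^2(\Omega)}.$$
   Context: $\mathbb{N}=\{1,2,3,\ldots\}$, $\mathbb{N}_0=\mathbb{N}\cup\{0\}$, $|\Omega|=b-a$. A grid size for $\Omega=(a,b)$ is a real $h>0$ such that $n_h:=h^{-1}(b-a)\in\mathbb{N}$. $H^r(\Omega)$ is the standard Sobolev space ($H^0=L^2$) and $|u|_{H^r(\Omega)}:=\|\frac{\partial^r}{\partial x^r}u\|_{L^2(\Omega)}$. $\mathbb{P}^p$ is the space of polynomials of degree at most $p$, and $$S_{p,h}(\Omega):=\{u\in H^p(\Omega): u|_{(a+hj,a+h(j+1)]}\in\mathbb{P}^p\text{ for all }j=0,\ldots,n_h-1\}.$$ The space of splines with vanishing odd derivatives, $\widetilde{S}_{p,h}(\Omega)$, is the space of all $u_{p,h}\in S_{p,h}(\Omega)$ satisfying $$\frac{\partial^{2l+1}}{\partial x^{2l+1}}u_{p,h}(a)=\frac{\partial^{2l+1}}{\partial x^{2l+1}}u_{p,h}(b)=0\quad\text{for all }l\in\mathbb{N}_0\text{ with }2l+1<p.$$ *)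

(* Defs.v *)
From HB Require Import structures.
From mathcomp Require Import all_boot all_order all_algebra.
From mathcomp Require Import all_classical all_reals all_analysis.

Set Implicit Arguments.
Unset Strict Implicit.
Unset Printing Implicit Defensive.

Import Order.TTheory GRing.Theory Num.Theory.
Import numFieldNormedType.Exports.

Local Open Scope classical_set_scope.
Local Open Scope ring_scope.

(* Functions on an open set Omega of the real line are represented by total
   functions R -> R, of which only the values on Omega matter. The operation
   u \_ Omega extends u by 0 outside Omega. *)

Definition L2 (R : realType) (Omega : set R) (u : R -> R) : Prop :=
  u \_ Omega \in Lfun (@lebesgue_measure R) 2%:E.

Definition L2norm (R : realType) (Omega : set R) (u : R -> R) : R :=
  fine ('N[@lebesgue_measure R]_2%:E[EFin \o u \_ Omega])%E.

(* C_c^oo(Omega) *)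
Definition test_function (R : realType) (Omega : set R) (phi : R -> R) : Prop :=
  (forall (k : nat) (x : R), derivable (derive1n k phi) x 1) /\
  exists K : set R, [/\ compact K, K `<=` Omega &
    forall x, ~ K x -> phi x = 0].

Definition is_weak_deriv (R : realType) (Omega : set R) (k : nat)
    (u v : R -> R) : Prop :=
  [/\ locally_integrable Omega u, locally_integrable Omega v &
    forall phi, test_function Omega phi ->
      \int[@lebesgue_measure R]_(x in Omega) (u x * derive1n k phi x) =
      (-1) ^+ k * \int[@lebesgue_measure R]_(x in Omega) (v x * phi x)].

(* Weak derivatives are unique up to null sets only: this picks one of them,
   and is 0 if there is none. *)
Definition weak_deriv (R : realType) (Omega : set R) (k : nat)
    (u : R -> R) : R -> R :=
  xget (cst 0) [set v | is_weak_deriv Omega k u v].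

Definition Sobolev (R : realType) (Omega : set R) (r : nat) (u : R -> R)
    : Prop :=
  L2 Omega u /\
  forall k : nat, (k <= r)%N ->
    exists v : R -> R, is_weak_deriv Omega k u v /\ L2 Omega v.

Definition Sobolev_seminorm (R : realType) (Omega : set R) (r : nat)
    (u : R -> R) : R :=
  L2norm Omega (weak_deriv Omega r u).

(* The value at x, possibly an endpoint, of the k-th derivative of u on ]a, b[
   is that of its representative which is continuous on [a, b]; for u in
   H^p(a, b) and k < p there is one, by the Sobolev embedding in dimension 1,
   and it is unique. *)
Definition deriv_value (R : realType) (a b : R) (k : nat) (u : R -> R)
    (x c : R) : Prop :=
  exists w : R -> R, [/\ is_weak_deriv `]a, b[ k u w,
    {within `[a, b], continuous w} & w x = c].

Definition grid_size (R : realType) (a b h : R) : Prop :=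
  0 < h /\ exists n : nat, (0 < n)%N /\ h^-1 * (b - a) = n%:R.

(* For a grid size h, the number h^-1 (b - a) is an integer, so that nothing is
   truncated. *)
Definition grid_count (R : realType) (a b h : R) : nat :=
  Num.truncn (h^-1 * (b - a)).

Definition spline (R : realType) (a b : R) (p : nat) (h : R) (u : R -> R)
    : Prop :=
  Sobolev `]a, b[ p u /\
  forall j : nat, (j < grid_count a b h)%N ->
    exists q : {poly R}, (size q <= p.+1)%N /\
      forall x, x \in `]a + h * j%:R, a + h * j.+1%:R] -> u x = q.[x].

Definition spline_odd0 (R : realType) (a b : R) (p : nat) (h : R)
    (u : R -> R) : Prop :=
  spline a b p h u /\
  forall l : nat, ((2 * l).+1 < p)%N ->
    deriv_value a b (2 * l).+1 u a 0 /\ deriv_value a b (2 * l).+1 u b 0.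

(* Main.v *)
Require Import Defs.
From mathcomp Require Import all_boot all_order all_algebra.
From mathcomp Require Import all_classical all_reals all_analysis.
From mathcomp Require Import measurable_realfun ring lra zify.
Import Order.TTheory GRing.Theory Num.Theory.
Import numFieldNormedType.Exports.
Local Open Scope classical_set_scope.
Local Open Scope ring_scope.

(* Write n = (b - a) / h and x_j = a + h j. A combination of the n - 1 truncated
   powers (x - x_i)_+^p, 0 < i < n, vanishes on [x_0, x_1]. As n > 2p, there are
   fewer than n - 1 linear conditions in asking that its derivatives of order
   1, ..., p - 1 vanish at b and that it vanish at x_2, x_4, ..., so some nonzero
   combination u meets them all. Then u vanishes at an endpoint of each cell,
   and the Poincare inequality on the cells gives |u|^2 <= 8 h^2 |u'|^2.

   The seminorm is that of some weak derivative of u, hence that of u' because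
   weak derivatives are unique almost everywhere: smooth cutoffs approximating
   the indicator of ]c, d[ show that two of them have the same integral over
   every such interval, and Lebesgue differentiation applies. The cutoffs are
   built from the functions q(1/t) exp(-1/t) for t > 0, 0 for t <= 0, with q a
   polynomial; derivation preserves this family, even at 0. *)

(** * Smooth bumps *)

Section bump.
Context {R : realType}.
Implicit Types (p : {poly R}) (f g : R -> R).

Definition expbump p (t : R) : R :=
  if 0 < t then p.[t^-1] * expR (- t^-1) else 0.

Lemma expbump_le0 p t : t <= 0 -> expbump p t = 0.
Proof. by move=> t0; rewrite /expbump ltNge t0. Qed.

(** With [s = t^-1], the exponential series bounds [s^(i+2)] by [(i+2)! exp s]. The quadratic decay
    makes the difference quotient at 0 tend to 0. *)
Lemma expbump_near0 p : exists C, forall t, `|expbump p t| <= C * t ^+ 2.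
Proof.
exists (\sum_(i < size p) `|p`_i| * (i.+2)`!%:R) => t.
have [t0|t0] := leP t 0.
  rewrite expbump_le0// normr0 mulr_ge0 ?sqr_ge0//.
  by apply: sumr_ge0 => i _; rewrite mulr_ge0.
have s0 : 0 < t^-1 by rewrite invr_gt0.
rewrite /expbump t0 -[t in t ^+ 2]invrK; move: (t^-1) s0 => s s0.
rewrite exprVn ler_pdivlMr ?exprn_gt0// normrM (ger0_norm (expR_ge0 _)) expRN.
rewrite mulrAC ler_pdivrMr ?expR_gt0// horner_coef mulr_suml.
apply: (le_trans (ler_wpM2r _ (ler_norm_sum _ _ _))); first exact: sqr_ge0.
rewrite !mulr_suml; apply: ler_sum => i _.
rewrite normrM -!mulrA ler_wpM2l//.
rewrite ger0_norm ?exprn_ge0 ?(ltW s0)// -exprD addn2.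
have := expR_ge1Dxn i.+1 (ltW s0).
rewrite -ler_pdivrMl ?ltr0n ?fact_gt0// => /(le_trans _); apply.
by rewrite mulrC lerDr.
Qed.

(** For [t > 0] the chain rule gives [t^-2 (p - p')(t^-1) exp(-t^-1)], whence the polynomial
    [X^2 (p - p')]. At 0 the difference quotient is squeezed between multiples of [|h|]. *)
Lemma is_derive_expbump p (t : R) :
  is_derive t 1 (expbump p) (expbump ('X^2 * (p - p^`())) t).
Proof.
have [t0|t0|->] := ltgtP t 0.
- rewrite [X in is_derive _ _ _ X]expbump_le0 1?ltW//.
  apply: (@near_eq_is_derive _ _ _ (cst 0)).
  near=> y; rewrite expbump_le0// ltW//; near: y.
  exact: lt_nbhsl.
- have tn0 : t != 0 by rewrite gt_eqF.
  pose F (y : R) : R := p.[y^-1] * expR (- y^-1).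
  apply: (@near_eq_is_derive R R R F); rewrite {}/F.
    near=> y; rewrite /expbump ifT//; near: y.
    exact: lt_nbhsr.
  have dV : is_derive t (1 : R) (fun y : R => y^-1) (- t ^- 2).
    by apply: (is_derive_eq (is_deriveV (f := id) tn0 _)); rewrite scaler1.
  have d1 : is_derive t (1 : R) (horner p \o (fun y : R => y^-1)) (p^`().[t^-1] * - t ^- 2).
    exact: is_derive1_comp.
  have d2 : is_derive t (1 : R) (expR \o (fun y : R => - y^-1)) (expR (- t^-1) * t ^- 2).
    apply: is_derive1_comp.
    by apply: (is_derive_eq (is_deriveN dV)); rewrite opprK.
  have /= := @is_deriveM _ _ _ _ _ _ _ _ d1 d2.
  rewrite /expbump t0 !hornerE /GRing.scale/= => d.
  apply: is_derive_eq d _.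
  by rewrite exprVn; ring.
- rewrite [X in is_derive _ _ _ X]expbump_le0//.
  have [C Cp] := expbump_near0 p.
  suff cv : h^-1 *: ((expbump p \o shift 0) (h *: 1) - expbump p 0) @[h --> 0^'] --> (0 : R).
    apply: DeriveDef; first by apply/cvg_ex; exists 0.
    exact/cvg_lim.
  have nh : `|h| @[h --> (0 : R)^'] --> (0 : R).
    have /continuous_withinNx := @norm_continuous R R 0.
    by rewrite normr0.
  apply: (@squeeze_cvgr _ _ _ _ (fun h => - (`|C| * `|h|)) (fun h => `|C| * `|h|)).
  + near=> h; rewrite -ler_norml /= addr0 [expbump p 0]expbump_le0// subr0.
    rewrite scaler1 normrM normfV.
    have h0 : h != 0 by near: h; exact: nbhs_dnbhs_neq.
    rewrite ler_pdivrMl ?normr_gt0// (le_trans (Cp _))//.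
    rewrite [leRHS]mulrCA -[`|h| * _]expr2 -normrX.
    rewrite [`|h ^+ 2|]ger0_norm ?sqr_ge0// ler_wpM2r ?sqr_ge0//.
    exact: ler_norm.
  + rewrite -[X in _ --> X]oppr0 -[X in _ --> - X](mulr0 `|C|); apply: cvgN.
    by apply: cvgM => //; exact: (@cvg_cst R).
  + by rewrite -[X in _ --> X](mulr0 `|C|); apply: cvgM => //; exact: (@cvg_cst R).
Unshelve. all: by end_near. Qed.

(** Closing the bumps under products as well as linear combinations makes the class stable under
    derivation, so that a single derivative yields all orders. *)
Inductive bump_algebra : (R -> R) -> Prop :=
| bump_atom p s c : bump_algebra (fun t => expbump p (s * t + c))
| bump_scale s f : bump_algebra f -> bump_algebra (fun t => s * f t)
| bump_add f g :
    bump_algebra f -> bump_algebra g -> bump_algebra (fun t => f t + g t)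
| bump_mul f g :
    bump_algebra f -> bump_algebra g -> bump_algebra (fun t => f t * g t).

Lemma bump_algebra_derive f : bump_algebra f ->
  exists2 g, bump_algebra g & forall t : R, is_derive t 1 f (g t).
Proof.
elim=> {f} [p s c|s f _ [f' Bf' df]|f g _ [f' Bf' df] _ [g' Bg' dg]
           |f g Bf [f' Bf' df] Bg [g' Bg' dg]].
- exists (fun t => s * expbump ('X^2 * (p - p^`())) (s * t + c)).
    by apply: bump_scale; exact: bump_atom.
  move=> t.
  have da : is_derive t (1 : R) (fun t : R => s * t + c) s.
    by apply: is_derive_eq; rewrite addr0 /GRing.scale/= mulr1.
  have d := @is_derive1_comp R (expbump p) (fun t : R => s * t + c) t _ _
    (is_derive_expbump p _) da.
  by apply: (is_derive_eq d); rewrite mulrC.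
- exists (fun t => s * f' t); first exact: bump_scale.
  by move=> t; apply: is_deriveZ.
- exists (fun t => f' t + g' t); first exact: bump_add.
  by move=> t; apply: is_deriveD.
- exists (fun t => f t * g' t + g t * f' t); last by move=> t; apply: is_deriveM.
  by apply: bump_add; apply: bump_mul.
Qed.

Lemma bump_algebra_smooth f : bump_algebra f ->
  forall k (x : R), derivable (derive1n k f) x 1.
Proof.
move=> + k; elim: k f => [|k IH] f Bf x; have [g Bg dg] := bump_algebra_derive _ Bf.
  by case: (dg x).
rewrite derive1Sn (_ : f^`()%classic = g); first exact: (IH _ Bg).
by apply/funext => t; rewrite derive1E derive_val.
Qed.

End bump.

(** * Test functions *)

Section test_functions.
Context {R : realType}.
Implicit Types (Om K : set R) (phi u v w : R -> R).
Notation mu := (@lebesgue_measure R).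

Lemma locally_integrable_integrable Om K u : locally_integrable Om u ->
  compact K -> K `<=` Om -> mu.-integrable K (EFin \o u).
Proof.
move=> [mu_ oOm fin_] cK KOm; apply/integrableP; split.
  by apply/measurable_EFinP; apply: measurable_funS mu_ => //; exact: open_measurable.
exact: fin_.
Qed.

(** On [K] the factor [phi] is bounded and [u] is integrable; off [K] the product is 0. *)
Lemma integrable_mul_compact_support Om K u phi : locally_integrable Om u ->
  continuous phi -> compact K -> K `<=` Om -> (forall x, ~ K x -> phi x = 0) ->
  mu.-integrable Om (EFin \o (fun x => u x * phi x)).
Proof.
move=> lu cphi cK KOm phi0; have iu := locally_integrable_integrable _ _ _ lu cK KOm.
have [_ oOm _] := lu.
have mK : measurable K by exact: compact_measurable.
have mOm : measurable Om by exact: open_measurable.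
have : mu.-integrable K ((EFin \o u) \* (EFin \o phi))%E.
  apply: (@integrableMl _ _ _ mu _ _ _ phi iu) => //.
    apply: (@measurable_funS _ _ _ _ setT) => //.
    exact: continuous_measurable_fun.
  have := @continuous_compact _ _ phi K.
  move=> /(_ (continuous_subspaceT cphi) cK) /compact_bounded.
  move=> [M [Mr MP]]; exists M; split => // x Mx y Ky.
  by apply: MP Mx _ _; exists y.
rewrite -(setIidr KOm) => /(integrable_restrict mu mK mOm).
apply: eq_integrable => // x _; rewrite patchE; case: ifPn => // /negP xK.
by rewrite /= phi0 ?mulr0// => Kx; apply: xK; rewrite inE.
Qed.

(** The complement of [K] is open, so [phi] is 0 in a whole neighbourhood of [x]. *)
Lemma derive1_support phi K : closed K -> (forall x, ~ K x -> phi x = 0) ->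
  forall x, ~ K x -> phi^`()%classic x = 0.
Proof.
move=> cK phi0 x Kx; have oK : open (~` K) by exact: closed_openC.
rewrite derive1E; apply: derive_val.
apply: (@near_eq_is_derive R R R (cst 0)).
have : nbhs x (~` K) by exact: open_nbhs_nbhs.
by apply: filterS => y /phi0 ->.
Qed.

Lemma test_function_derive1n Om phi k : test_function Om phi ->
  test_function Om (derive1n k phi).
Proof.
elim: k => [//|k IH] /IH[dphi [K [cK KOm phi0]]]; rewrite derive1nS; split.
  by move=> j x; rewrite -derive1Sn; exact: dphi.
exists K; split => //; apply: derive1_support => //.
exact: compact_closed.
Qed.

Lemma test_function_continuous Om phi : test_function Om phi -> continuous phi.
Proof.
by move=> [/(_ 0%N) dphi _] x; apply/differentiable_continuous/derivable1_diffP/dphi.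
Qed.

Lemma integrable_mul_test Om u phi : locally_integrable Om u ->
  test_function Om phi -> mu.-integrable Om (EFin \o (fun x => u x * phi x)).
Proof.
move=> lu tphi; have [_ [K [cK KOm phi0]]] := tphi.
apply: integrable_mul_compact_support cK KOm phi0 => //.
exact: test_function_continuous tphi.
Qed.

(** A smooth approximation of the indicator of []c, d[], steeper as [n] grows. The arguments are
    spelled in the affine form of [bump_atom], and [n.+1] keeps the slopes nonzero. *)
Definition cutoff (c d : R) (n : nat) (x : R) : R :=
  expbump 1 (n.+1%:R * x + - (n.+1%:R * c)) *
  expbump 1 (- n.+1%:R * x + n.+1%:R * d).

Lemma cutoffE c d n x :
  cutoff c d n x = expbump 1 (n.+1%:R * (x - c)) * expbump 1 (n.+1%:R * (d - x)).
Proof. by rewrite /cutoff; congr (expbump _ _ * expbump _ _); ring. Qed.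

Lemma cutoff_out c d n x : ~ (c < x < d) -> cutoff c d n x = 0.
Proof.
move=> /negP; rewrite negb_and -!leNgt cutoffE => /orP[xc|dx].
  by rewrite expbump_le0 ?mul0r// pmulr_rle0// subr_le0.
by rewrite [expbump _ (_ * (d - x))]expbump_le0 ?mulr0// pmulr_rle0// subr_le0.
Qed.

Lemma expbump1_ge0 (t : R) : 0 <= expbump 1 t.
Proof. by rewrite /expbump; case: ifP => // _; rewrite hornerE mul1r expR_ge0. Qed.

Lemma expbump1_le1 (t : R) : expbump 1 t <= 1.
Proof.
rewrite /expbump; case: ifP => // t0; rewrite hornerE mul1r.
by rewrite -[leRHS]expR0 ler_expR oppr_le0 invr_ge0 ltW.
Qed.

Lemma norm_cutoff_le1 c d n x : `|cutoff c d n x| <= 1.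
Proof.
rewrite cutoffE ger0_norm ?mulr_ge0 ?expbump1_ge0//.
by rewrite mulr_ile1 ?expbump1_ge0 ?expbump1_le1.
Qed.

(** Each factor is [exp(-(n+1)^-1 / t)], where [t > 0] is the distance from [x] to an endpoint. *)
Lemma cvg_cutoff c d x : c < x < d -> cutoff c d n x @[n --> \oo] --> (1 : R).
Proof.
suff h (t : R) : 0 < t -> expbump 1 (n.+1%:R * t) @[n --> \oo] --> (1 : R).
  move=> /andP[cx xd]; rewrite -[X in _ --> X](mulr1 1).
  rewrite (_ : cutoff c d ^~ x = (fun n => expbump 1 (n.+1%:R * (x - c)) *
      expbump 1 (n.+1%:R * (d - x)))); last by apply/funext => n; rewrite cutoffE.
  by apply: cvgM; apply: h; rewrite subr_gt0.
move=> t0.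
rewrite (_ : (fun n => _) = (fun n => expR (- n.+1%:R^-1 / t))); last first.
  by apply/funext => n; rewrite /expbump pmulr_rgt0// t0 hornerE mul1r invfM -mulNr.
rewrite -[X in _ --> X]expR0; apply: continuous_cvg; first exact: continuous_expR.
rewrite -[X in _ --> X](mul0r t^-1); apply: cvgM; last exact: (@cvg_cst R).
by rewrite -[X in _ --> X]oppr0; apply: cvgN; exact: cvg_harmonic.
Qed.

Lemma test_function_cutoff Om c d n : `[c, d] `<=` Om ->
  test_function Om (cutoff c d n).
Proof.
move=> cdOm; split.
  by apply: bump_algebra_smooth; apply: bump_mul; exact: bump_atom.
exists [set` `[c, d]]; split => //; first exact: segment_compact.
move=> x xcd; apply: cutoff_out => /andP[cx xd]; apply: xcd.
by rewrite /= in_itv/= !ltW.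
Qed.

(** Dominated convergence: the integrands vanish off []c, d[] and are bounded there by [|v|], which
    is integrable because [[c, d]] is a compact subset of [Om]. *)
Lemma cvg_integral_cutoff Om v c d : locally_integrable Om v ->
  `[c, d] `<=` Om ->
  \int[mu]_(x in Om) (v x * cutoff c d n x) @[n --> \oo] -->
  \int[mu]_(x in `]c, d[) v x.
Proof.
move=> lv cdOm; have [_ oOm _] := lv.
have cdOm' : `]c, d[ `<=` Om by apply: subset_trans cdOm; exact: subset_itv_oo_cc.
have iv : mu.-integrable `]c, d[ (EFin \o v).
  apply: (@integrableS _ _ _ mu `[c, d]) => //; first exact: subset_itv_oo_cc.
  by apply: locally_integrable_integrable cdOm => //; exact: segment_compact.
have mv := measurable_int mu iv.
rewrite (_ : (fun n => _) =
    (fun n => \int[mu]_(x in `]c, d[) (v x * cutoff c d n x))); last first.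
  apply/funext => n; rewrite -(setIidr cdOm') Rintegral_mkcondr.
  apply: eq_Rintegral => x _.
  rewrite patchE; case: ifPn => // /negP; rewrite inE/= in_itv/= => xcd.
  by rewrite cutoff_out// mulr0.
apply: fine_cvg.
rewrite fineK; last exact: integrable_fin_num.
have [| | | | | _ _] := @dominated_convergence _ _ _ mu `]c, d[ (measurable_itv _)
  (fun n x => (v x * cutoff c d n x)%:E) (EFin \o v) (abse \o (EFin \o v)).
- move=> n; apply/measurable_EFinP; apply: measurable_funM; first exact/measurable_EFinP.
  apply: (@measurable_funS _ _ _ _ setT) => //.
  apply: continuous_measurable_fun.
  exact: test_function_continuous (test_function_cutoff _ _ _ _ cdOm).
- exact: mv.
- apply: aeW => x /=; rewrite in_itv/= => xcd; apply: cvg_EFin; first exact: nearW.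
  rewrite -[X in _ --> X]mulr1; apply: cvgM; first exact: (@cvg_cst R).
  exact: cvg_cutoff.
- exact: integrable_abse.
- apply: aeW => x n _ /=; rewrite lee_fin normrM -[leRHS]mulr1.
  by rewrite ler_wpM2l// norm_cutoff_le1.
- by [].
Qed.

End test_functions.

(** * Uniqueness of weak derivatives *)

Section weak_unique.
Context {R : realType}.
Implicit Types (u v w : R -> R).
Notation mu := (@lebesgue_measure R).

(** By Lebesgue differentiation, almost every value of [f] is the derivative of its primitive from
    [c], and this primitive is 0 near [x]. *)
Lemma Rintegral_eq0_ae (f : R -> R) (c d : R) :
  mu.-integrable `[c, d] (EFin \o f) ->
  (forall x, c < x < d -> \int[mu]_(t in `]c, x[) f t = 0) ->
  {ae mu, forall x, c < x < d -> f x = 0}.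
Proof.
move=> intf f0; pose g := f \_ `[c, d].
have intg A : measurable A -> mu.-integrable A (EFin \o g).
  move=> mA; rewrite /g -restrict_EFin.
  apply/(integrable_restrict mu (measurable_itv _) mA).
  by apply: integrableS intf => //; exact: measurableI.
have lg : locally_integrable setT g.
  by apply: integrable_locally => //; exact: measurable_itv.
have := FTC1 (a := BLeft c) (fun y => intg _ (measurable_itv _)) lg.
apply: (@filterS _ _ (ae_filter_ringOfSetsType mu)) => x + /andP[cx xd].
rewrite lte_fin => /(_ cx)[_ ].
rewrite {2}/g patchE mem_set/=; last by rewrite in_itv/= !ltW.
move=> <-; rewrite derive1E; apply: derive_val.
apply: (@near_eq_is_derive R R R (cst 0)).
near=> y; rewrite /=.
have cy : c < y by near: y; exact: lt_nbhsr.
have yd : y < d by near: y; exact: lt_nbhsl.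
rewrite -Rintegral_itv_bndo_bndc; last by apply: intg; exact: measurable_itv.
rewrite -Rintegral_itv_obnd_cbnd; last by apply: intg; exact: measurable_itv.
rewrite -[LHS](f0 y); last by rewrite cy.
apply: eq_Rintegral => t; rewrite inE/= in_itv/= => /andP[ct ty].
by rewrite /g patchE mem_set//= in_itv/= !ltW// (lt_trans ty).
Unshelve. all: by end_near. Qed.

Lemma weak_deriv_ae_eq (a b : R) k u v w : is_weak_deriv `]a, b[ k u v ->
  is_weak_deriv `]a, b[ k u w -> {ae mu, forall x, a < x < b -> v x = w x}.
Proof.
move=> [_ lv uv] [_ lw uw].
have [ab|ba] := ltP a b; last first.
  by apply: aeW => x /andP[ax xb]; have := lt_le_trans (lt_trans ax xb) ba; rewrite ltxx.
have eqint c d : a < c -> d < b ->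
    \int[mu]_(x in `]c, d[) v x = \int[mu]_(x in `]c, d[) w x.
  move=> ac db; have cdab : `[c, d] `<=` `]a, b[.
    by move=> x; rewrite /= !in_itv/= => /andP[cx xd]; rewrite (lt_le_trans ac)//= (le_lt_trans xd).
  have cv := cvg_integral_cutoff _ _ _ _ lv cdab.
  have cw := cvg_integral_cutoff _ _ _ _ lw cdab.
  apply: (cvg_unique _ cv); first exact: Rhausdorff.
  rewrite (_ : (fun n => _) = (fun n => \int[mu]_(x in `]a, b[) (w x * cutoff c d n x)))//.
  apply/funext => n; have tn := test_function_cutoff _ _ _ n cdab.
  have := uv _ tn; rewrite uw// => /mulfI -> //.
  by rewrite signr_eq0.
(* [v] and [w] are only locally integrable, so the claim is proved on the compact intervals
   [[a + e n, b - e n]]. They exhaust []a, b[], and countably many null sets have a null union. *)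
pose e n : R := (b - a) / n.+3%:R.
have e0 n : 0 < e n by rewrite divr_gt0 ?subr_gt0.
have : {ae mu, forall x, forall n, a + e n < x < b - e n -> v x - w x = 0}.
  apply: ae_foralln => n.
  have sub : `[a + e n, b - e n] `<=` `]a, b[.
    move=> x; rewrite /= !in_itv/= => /andP[cx xd].
    by rewrite (lt_le_trans _ cx) ?ltrDl//= (le_lt_trans xd)// gtrBl.
  have iv := locally_integrable_integrable _ _ _ lv (@segment_compact _ _ _) sub.
  have iw := locally_integrable_integrable _ _ _ lw (@segment_compact _ _ _) sub.
  apply: (Rintegral_eq0_ae (fun x => v x - w x)).
    by apply: eq_integrable (integrableB _ iv iw) => //; exact: measurable_itv.
  move=> x /andP[ax xb].
  have subx : `]a + e n, x[ `<=` `[a + e n, b - e n].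
    by move=> y; rewrite /= !in_itv/= => /andP[cy yx]; rewrite ltW//= ltW// (lt_trans yx).
  rewrite RintegralB//.
  - by rewrite eqint ?subrr ?ltrDl// (lt_trans xb)// gtrBl.
  - by apply: integrableS iv.
  - by apply: integrableS iw.
apply: (@filterS _ _ (ae_filter_ringOfSetsType mu)) => x vw /andP[ax xb].
apply/eqP; rewrite -subr_eq0; apply/eqP.
have cvge : e n @[n --> \oo] --> 0.
  rewrite -[X in _ --> X](mulr0 (b - a)); apply: cvgM; first exact: (@cvg_cst R).
  have := @cvg_harmonic R; rewrite -(cvg_shiftn 2).
  by rewrite (_ : (fun n => _) = (fun n => n.+3%:R^-1))//; apply/funext => n; rewrite addn2.
have : \forall n \near \oo, e n < x - a.
  by apply: (cvgr_lt _ cvge); rewrite subr_gt0.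
have : \forall n \near \oo, e n < b - x.
  by apply: (cvgr_lt _ cvge); rewrite subr_gt0.
move=> [N1 _ N1P] [N2 _ N2P].
have := N1P (maxn N1 N2) (leq_maxl _ _).
have := N2P (maxn N1 N2) (leq_maxr _ _).
move=> /= h1 h2; apply: (vw (maxn N1 N2)); lra.
Qed.

End weak_unique.

(** * Weak derivatives of truncated powers *)

Section weak_linear.
Context {R : realType}.
Implicit Types (Om : set R) (u v w phi : R -> R).
Notation mu := (@lebesgue_measure R).

Lemma locally_integrableZ Om (r : R) u :
  locally_integrable Om u -> locally_integrable Om (fun x => r * u x).
Proof.
move=> lu; have [mu_ oOm _] := lu; split => //.
  by apply: measurable_funM => //; exact: measurable_cst.
move=> K KOm cK.
have iu := locally_integrable_integrable _ _ _ lu cK KOm.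
have mK : measurable K by exact: compact_measurable.
have : mu.-integrable K (fun x => r%:E * (EFin \o u) x)%E by exact: integrableZl.
by move=> /integrableP[].
Qed.

Lemma is_weak_derivZ Om k (r : R) u v : is_weak_deriv Om k u v ->
  is_weak_deriv Om k (fun x => r * u x) (fun x => r * v x).
Proof.
move=> [lu lv uv]; have [_ oOm _] := lu.
have mOm : measurable Om by exact: open_measurable.
split; [exact: locally_integrableZ..|] => phi tphi.
have iu := integrable_mul_test _ _ _ lu (test_function_derive1n _ _ k tphi).
have iv := integrable_mul_test _ _ _ lv tphi.
transitivity (\int[mu]_(x in Om) (r * (u x * phi^`(k)%classic x))).
  by apply: eq_Rintegral => x _; rewrite mulrA.
rewrite RintegralZl// uv// mulrCA -RintegralZl//.
by congr (_ * _); apply: eq_Rintegral => x _; rewrite mulrA.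
Qed.

Lemma is_weak_derivD Om k u1 u2 v1 v2 : is_weak_deriv Om k u1 v1 ->
  is_weak_deriv Om k u2 v2 ->
  is_weak_deriv Om k (fun x => u1 x + u2 x) (fun x => v1 x + v2 x).
Proof.
move=> [lu1 lv1 uv1] [lu2 lv2 uv2]; have [_ oOm _] := lu1.
have mOm : measurable Om by exact: open_measurable.
split; [exact: locally_integrableD..|] => phi tphi.
have iu1 := integrable_mul_test _ _ _ lu1 (test_function_derive1n _ _ k tphi).
have iv1 := integrable_mul_test _ _ _ lv1 tphi.
have iu2 := integrable_mul_test _ _ _ lu2 (test_function_derive1n _ _ k tphi).
have iv2 := integrable_mul_test _ _ _ lv2 tphi.
transitivity (\int[mu]_(x in Om)
    (u1 x * phi^`(k)%classic x + u2 x * phi^`(k)%classic x)).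
  by apply: eq_Rintegral => x _; rewrite mulrDl.
rewrite RintegralD// uv1// uv2// -mulrDr -RintegralD//.
by congr (_ * _); apply: eq_Rintegral => x _; rewrite mulrDl.
Qed.

Lemma is_weak_deriv0 Om k : open Om -> is_weak_deriv Om k (cst 0) (cst 0).
Proof.
move=> oOm.
have l0 : locally_integrable Om (cst 0 : R -> R).
  by apply: open_integrable_locally => //; exact: integrable0.
have int0 phi : \int[mu]_(x in Om) (0 * phi x) = 0.
  by rewrite /Rintegral integral0_eq// => x _; rewrite mul0r.
by split => // phi _; rewrite !int0 mulr0.
Qed.

Lemma is_weak_deriv_sum Om k n (d : 'I_n -> R) (u v : 'I_n -> R -> R) :
  open Om -> (forall i, is_weak_deriv Om k (u i) (v i)) ->
  is_weak_deriv Om k (fun x => \sum_(i < n) d i * u i x)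
                     (fun x => \sum_(i < n) d i * v i x).
Proof.
move=> oOm uv; elim: n d u v uv => [|n IH] d u v uv.
  rewrite [X in is_weak_deriv _ _ X](_ : _ = cst 0); last first.
    by apply/funext => x; rewrite big_ord0.
  rewrite [X in is_weak_deriv _ _ _ X](_ : _ = cst 0); last first.
    by apply/funext => x; rewrite big_ord0.
  exact: is_weak_deriv0.
rewrite [X in is_weak_deriv _ _ X](_ : _ = fun x =>
    \sum_(i < n) d (widen_ord (leqnSn n) i) * u (widen_ord (leqnSn n) i) x +
    d ord_max * u ord_max x); last first.
  by apply/funext => x; rewrite big_ord_recr.
rewrite [X in is_weak_deriv _ _ _ X](_ : _ = fun x =>
    \sum_(i < n) d (widen_ord (leqnSn n) i) * v (widen_ord (leqnSn n) i) x +
    d ord_max * v ord_max x); last first.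
  by apply/funext => x; rewrite big_ord_recr.
by apply: is_weak_derivD; [exact: IH|exact: is_weak_derivZ].
Qed.

End weak_linear.

(** * Truncated powers and integration by parts *)

Section truncated_power.
Context {R : realType}.
Implicit Types (a b c x : R) (m k p : nat) (phi : R -> R).
Notation mu := (@lebesgue_measure R).

(** The strict inequality makes [tpow 0 c], a Heaviside function, vanish at [c]; this suits grid
    cells that are closed on the right. *)
Definition tpow m c x : R := if c < x then (x - c) ^+ m else 0.

Lemma tpowE m c : tpow m c = (fun x => (x - c) ^+ m) \_ `]c, +oo[.
Proof.
by apply/funext => x; rewrite patchE /tpow mem_setE in_itv/= andbT.
Qed.

Lemma shift_expE m c : (fun x => (x - c) ^+ m) = horner (('X - c%:P) ^+ m).
Proof. by apply/funext => x; rewrite horner_exp hornerXsubC. Qed.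

Lemma continuous_shift_exp m c : continuous (fun x => (x - c) ^+ m).
Proof.
rewrite shift_expE => x; apply/differentiable_continuous/derivable1_diffP.
exact: derivable_horner.
Qed.

Lemma is_derive_shift_exp m c x :
  is_derive x (1 : R) (fun x => (x - c) ^+ m.+1) (m.+1%:R * (x - c) ^+ m).
Proof.
rewrite shift_expE; apply: (is_derive_eq (is_derive_poly _ _)).
by rewrite deriv_exp derivXsubC mul1r hornerMn horner_exp hornerXsubC mulr_natl.
Qed.

Lemma measurable_tpow m c (A : set R) : measurable A -> measurable_fun A (tpow m c).
Proof.
move=> mA; apply: (@measurable_funS _ _ _ _ setT) => //; rewrite tpowE.
apply/(measurable_restrictT _ _).1 => //.
apply: (@measurable_funS _ _ _ _ setT) => //.
by apply: continuous_measurable_fun; exact: continuous_shift_exp.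
Qed.

Lemma norm_tpow_le m a b c x : a <= c -> x <= b -> a <= b -> `|tpow m c x| <= (b - a) ^+ m.
Proof.
move=> ac xb ab; rewrite /tpow; case: ifPn => cx; last first.
  by rewrite normr0 exprn_ge0// subr_ge0.
rewrite ger0_norm ?exprn_ge0 ?subr_ge0 ?(ltW cx)//.
by rewrite lerXn2r ?nnegrE ?subr_ge0 ?(ltW cx)// lerB.
Qed.

Lemma integrable_tpow m a b c : a <= c -> a <= b -> mu.-integrable `]a, b[ (EFin \o tpow m c).
Proof.
move=> ac ab; apply: measurable_bounded_integrable => //.
- by rewrite /= lebesgue_measure_itv/=; case: ifPn; rewrite ltry.
- exact: measurable_tpow.
- exists ((b - a) ^+ m); split; first exact: num_real.
  move=> M Mlt x /=; rewrite in_itv/= => /andP[_ xb].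
  by rewrite (le_trans _ (ltW Mlt))// norm_tpow_le// ltW.
Qed.

(** Brings the integral to a closed interval on which no truncation remains, ready for integration
    by parts; endpoints are null sets. *)
Lemma Rintegral_tpow m a b c (g : R -> R) : a <= c -> continuous g ->
  \int[mu]_(x in `]a, b[) (tpow m c x * g x) =
  \int[mu]_(x in `[c, b]) ((x - c) ^+ m * g x).
Proof.
move=> ac cg.
have ig : mu.-integrable `[c, b] (EFin \o (fun x => (x - c) ^+ m * g x)).
  apply: continuous_compact_integrable; first exact: segment_compact.
  apply: continuous_subspaceT => x; apply: cvgM; last exact: cg.
  exact: continuous_shift_exp.
rewrite -Rintegral_itv_obnd_cbnd; last first.
  by apply: integrableS ig => //; exact: subset_itv_oc_cc.
rewrite -Rintegral_itv_bndo_bndc; last first.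
  by apply: integrableS ig => //; exact: subset_itv_oo_cc.
rewrite (_ : [set` `]c, b[] = `]a, b[ `&` `]c, +oo[); last first.
  apply/seteqP; split => x /=; rewrite !in_itv/= andbT.
    by move=> /andP[cx ->]; rewrite cx (le_lt_trans ac).
  by move=> [/andP[_ ->] ->].
rewrite Rintegral_mkcondr; apply: eq_Rintegral => x _.
by rewrite tpowE !patchE; case: ifPn; rewrite ?mul0r.
Qed.

(** Integration by parts on [[c, b]]: the boundary term vanishes at [c] since the exponent [m.+1] is
    positive, and at [b] since [phi b = 0]. *)
Lemma Rintegral_tpow_deriv m a b c phi : a <= c -> c < b ->
  (forall x, derivable phi x 1) -> continuous phi^`()%classic -> phi b = 0 ->
  \int[mu]_(x in `]a, b[) (tpow m.+1 c x * phi^`()%classic x) =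
  - (m.+1%:R * \int[mu]_(x in `]a, b[) (tpow m c x * phi x)).
Proof.
move=> ac cb dphi cphi' phib.
have cphi : continuous phi by move=> x; apply/differentiable_continuous/derivable1_diffP.
rewrite !Rintegral_tpow//.
have LR (F : R -> R) : (forall x, derivable F x 1) -> derivable_oo_LRcontinuous F c b.
  move=> dF; have cF : continuous F by move=> x; apply/differentiable_continuous/derivable1_diffP.
  by split; [by []|apply: cvg_at_right_filter|apply: cvg_at_left_filter]; exact: cF.
rewrite (Rintegration_by_parts (f := fun x => m.+1%:R * (x - c) ^+ m) (G := phi))//.
- rewrite phib subrr expr0n/= !mulr0 mul0r subrr sub0r; congr (- _).
  rewrite -RintegralZl//; first by apply: eq_Rintegral => x _; rewrite mulrA.
  apply: continuous_compact_integrable; first exact: segment_compact.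
  apply: continuous_subspaceT => x; apply: cvgM; last exact: cphi.
  exact: continuous_shift_exp.
- apply: continuous_subspaceT => x; apply: cvgM; first exact: (@cvg_cst R).
  exact: continuous_shift_exp.
- by apply: LR => x; have := is_derive_shift_exp m c x; case.
- by move=> x _; rewrite derive1E; apply: derive_val; exact: is_derive_shift_exp.
- exact: continuous_subspaceT.
- exact: LR.
Qed.

Lemma test_function_endpoint a b phi : test_function `]a, b[ phi -> phi b = 0.
Proof.
move=> [_ [K [_ Kab phi0]]]; apply: phi0 => /Kab.
by rewrite /= in_itv/= ltxx andbF.
Qed.

Lemma is_weak_deriv_tpow p k a b c : a <= c -> c < b -> (k <= p)%N ->
  is_weak_deriv `]a, b[ k (tpow p c) (fun x => (p ^_ k)%:R * tpow (p - k) c x).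
Proof.
move=> ac cb kp.
have ab := le_lt_trans ac cb.
have lt q : locally_integrable `]a, b[ (tpow q c).
  apply: open_integrable_locally; first exact: itv_open.
  by apply: integrable_tpow => //; exact: ltW.
split => //; first exact: locally_integrableZ.
move=> phi tphi.
transitivity ((-1) ^+ k * ((p ^_ k)%:R * \int[mu]_(x in `]a, b[) (tpow (p - k) c x * phi x))).
  (* Each integration by parts lowers both [p] and [k] by one, so [p] varies in the induction; the
     factors collect into the falling factorial. As [k <= p], the exponent is positive before each
     integration. *)
  elim: k p kp => [|k IH] [|p]//; rewrite ?ltnS => kp.
  + by rewrite expr0 !mul1r.
  + by rewrite expr0 ffactn0 !mul1r.
  rewrite derive1nS Rintegral_tpow_deriv//.
  - by rewrite IH// ffactSS subSS natrM exprS; ring.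
  - by case: (test_function_derive1n _ _ k tphi) => + _ => /(_ 0%N).
  - rewrite -derive1nS.
    exact: test_function_continuous (test_function_derive1n _ _ k.+1 tphi).
  - exact: test_function_endpoint (test_function_derive1n _ _ k tphi).
rewrite -RintegralZl//.
- by congr (_ * _); apply: eq_Rintegral => x _; rewrite mulrA.
- exact: integrable_mul_test tphi.
Qed.

End truncated_power.

(** * The L2 norm and the Poincare inequality *)

Section L2.
Context {R : realType}.
Implicit Types (Om : set R) (u v w : R -> R).
Notation mu := (@lebesgue_measure R).

Lemma Lnorm2_restrict Om u :
  ('N[mu]_2%:E[EFin \o u \_ Om] = (\int[mu]_(x in Om) (u x ^+ 2)%:E) `^ 2^-1)%E.
Proof.
rewrite unlock; congr (_ `^ _)%E; rewrite [in RHS]integral_mkcond.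
apply: eq_integral => x _ /=; rewrite !patchE.
have two (y : R) : `|y| `^ 2 = y ^+ 2.
  by rewrite powR_mulrn// real_normK// num_real.
by case: ifPn => _ /=; rewrite two// expr0n.
Qed.

Lemma L2normE Om u : L2norm Om u = Num.sqrt (\int[mu]_(x in Om) (u x ^+ 2)).
Proof.
rewrite /L2norm Lnorm2_restrict /Rintegral.
have : (0 <= \int[mu]_(x in Om) (u x ^+ 2)%:E)%E.
  by apply: integral_ge0 => x _; rewrite lee_fin sqr_ge0.
case: (integral _ _ _) => [r r0||]//=.
- by rewrite powR12_sqrt.
(* When the integral is infinite, [fine] turns both sides into 0. *)
- by rewrite invr_eq0 pnatr_eq0 /= sqrtr0.
Qed.

Lemma integrable_sqr_bounded Om u M : measurable Om -> (mu Om < +oo)%E ->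
  measurable_fun Om u -> (forall x, Om x -> `|u x| <= M) ->
  mu.-integrable Om (EFin \o (fun x => u x ^+ 2)).
Proof.
move=> mOm fOm mu_ uM; apply: measurable_bounded_integrable => //.
  exact: measurable_funX.
exists (M ^+ 2); split; first exact: num_real.
move=> N MN x Omx /=; rewrite (le_trans _ (ltW MN))// normrX.
by have ux := uM _ Omx; rewrite lerXn2r ?nnegrE// (le_trans _ ux).
Qed.

Lemma L2_bounded Om u M : measurable Om -> (mu Om < +oo)%E ->
  measurable_fun Om u -> (forall x, Om x -> `|u x| <= M) -> L2 Om u.
Proof.
move=> mOm fOm mu_ uM.
apply/andP; split; rewrite inE/=.
  by apply/(measurable_restrictT _ _).1.
rewrite /finite_norm Lnorm2_restrict.
have i2 := integrable_sqr_bounded Om u M mOm fOm mu_ uM.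
have /fineK <- : (\int[mu]_(x in Om) (u x ^+ 2)%:E)%E \is a fin_num.
  exact: integrable_fin_num i2.
by rewrite poweR_EFin ltry.
Qed.

Lemma L2norm_ae Om u v : measurable Om -> measurable_fun Om u ->
  measurable_fun Om v -> {ae mu, forall x, Om x -> u x = v x} ->
  L2norm Om u = L2norm Om v.
Proof.
move=> mOm mu_ mv uv; rewrite !L2normE; congr (Num.sqrt (fine _)).
apply: ae_eq_integral => //.
- by apply/measurable_EFinP; exact: measurable_funX.
- by apply/measurable_EFinP; exact: measurable_funX.
- by apply: (@filterS _ _ (ae_filter_ringOfSetsType mu)) uv => x uv /uv ->.
Qed.

End L2.

(** * The Poincare inequality on one cell and on a grid *)

Section poincare.
Context {R : realType}.
Implicit Types (q : {poly R}) (a c h x : R).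
Notation mu := (@lebesgue_measure R).

Lemma continuous_horner q : continuous (horner q).
Proof.
by move=> x; apply/differentiable_continuous/derivable1_diffP; exact: derivable_horner.
Qed.

Lemma integrable_horner q a c : mu.-integrable `[a, c] (EFin \o horner q).
Proof.
apply: continuous_compact_integrable; first exact: segment_compact.
by apply: continuous_subspaceT; exact: continuous_horner.
Qed.

Lemma Rintegral_deriv_poly q a c : a < c ->
  \int[mu]_(x in `[a, c]) q^`().[x] = q.[c] - q.[a].
Proof.
move=> ac; rewrite /Rintegral (@continuous_FTC2 _ _ (horner q))//.
- by apply: continuous_subspaceT; exact: continuous_horner.
- split.
  + by move=> x _; exact: derivable_horner.
  + by apply: cvg_at_right_filter; exact: continuous_horner.
  + by apply: cvg_at_left_filter; exact: continuous_horner.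
- by move=> x _; rewrite derive1E; apply: derive_val; exact: is_derive_poly.
Qed.

(* If e is the other endpoint, (x - e) q^2 vanishes at both ends, and q^2 is at
   most 4 h^2 q'^2 plus a multiple of its derivative. *)
Lemma poincare_poly q c h : 0 < h -> q.[c] = 0 \/ q.[c + h] = 0 ->
  0 <= \int[mu]_(x in `[c, c + h]) (8 * h ^+ 2 * q^`().[x] ^+ 2 - q.[x] ^+ 2).
Proof.
move=> h0 q0.
have ch : c < c + h by rewrite ltrDl.
have [e [e1 e2 Ge]] : exists e, [/\ c <= e, e <= c + h &
    (c - e) * q.[c] ^+ 2 = 0 /\ (c + h - e) * q.[c + h] ^+ 2 = 0].
  case: q0 => ->.
    by exists (c + h); split; rewrite ?(ltW ch)// subrr expr0n/= mulr0 mul0r.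
  by exists c; split; rewrite ?(ltW ch)// subrr expr0n/= mulr0 mul0r.
pose G := ('X - e%:P) * q ^+ 2.
have GE x : G^`().[x] = q.[x] ^+ 2 + 2 * (x - e) * q.[x] * q^`().[x].
  by rewrite /G derivM derivXsubC mul1r deriv_exp !hornerE/=; ring.
have intG : \int[mu]_(x in `[c, c + h]) ((-2) *: G)^`().[x] = 0.
  have GH x : G.[x] = (x - e) * q.[x] ^+ 2 by rewrite /G !hornerE.
  rewrite Rintegral_deriv_poly// !hornerZ !GH.
  by case: Ge => -> ->; rewrite subrr.
rewrite -[leLHS]intG; apply: le_Rintegral => //.
- exact: integrable_horner.
- pose P := (8 * h ^+ 2) *: q^`() ^+ 2 - q ^+ 2.
  apply: eq_integrable (integrable_horner P c (c + h)) => // x _.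
  by rewrite /P /= !hornerE.
- move=> x; rewrite /= in_itv/= => /andP[cx xc].
  rewrite derivZ hornerZ GE.
  move: (q.[x]) (q^`().[x]) => y z.
  (* The integrand minus [-2 G'] equals [(y + 2(x - e)z)^2 + 4(h^2 - (x - e)^2)z^2 + 4h^2 z^2], and
     [|x - e| <= h] on the cell. *)
  have : 0 <= (y + 2 * (x - e) * z) ^+ 2 by exact: sqr_ge0.
  have : 0 <= (h ^+ 2 - (x - e) ^+ 2) * z ^+ 2.
    by rewrite mulr_ge0 ?sqr_ge0// subr_sqr mulr_ge0//; lra.
  have : 0 <= h ^+ 2 * z ^+ 2 by rewrite mulr_ge0 ?sqr_ge0.
  lra.
Qed.

(** Induction on the number of cells: each one adds a nonnegative integral of [8 h^2 w^2 - u^2] by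
    [poincare_poly]. Only the open cells are constrained, so [w] may jump at the knots, as the
    derivative does for degree 1. *)
Lemma poincare_piecewise a h n (u w : R -> R) (q : nat -> {poly R}) : 0 < h ->
  mu.-integrable `]a, a + h * n%:R[ (EFin \o (fun x => u x ^+ 2)) ->
  mu.-integrable `]a, a + h * n%:R[ (EFin \o (fun x => w x ^+ 2)) ->
  (forall j, (j < n)%N ->
     (q j).[a + h * j%:R] = 0 \/ (q j).[a + h * j.+1%:R] = 0) ->
  (forall j x, (j < n)%N -> a + h * j%:R < x < a + h * j.+1%:R ->
     u x = (q j).[x] /\ w x = (q j)^`().[x]) ->
  \int[mu]_(x in `]a, a + h * n%:R[) (u x ^+ 2) <=
  8 * h ^+ 2 * \int[mu]_(x in `]a, a + h * n%:R[) (w x ^+ 2).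
Proof.
move=> h0 iu iw q0 uw.
have mI (I : interval R) : measurable [set` I] by exact: measurable_itv.
have iw8 : mu.-integrable `]a, a + h * n%:R[
    (EFin \o (fun x => 8 * h ^+ 2 * w x ^+ 2)).
  have : mu.-integrable `]a, a + h * n%:R[
      (fun x => (8 * h ^+ 2)%:E * (EFin \o (fun x => w x ^+ 2)%R) x)%E.
    exact: integrableZl.
  exact: eq_integrable.
rewrite -subr_ge0 -RintegralZl// -RintegralB//.
have iF : mu.-integrable `]a, a + h * n%:R[
    (EFin \o (fun x => 8 * h ^+ 2 * w x ^+ 2 - u x ^+ 2)).
  have : mu.-integrable `]a, a + h * n%:R[
      ((EFin \o (fun x => 8 * h ^+ 2 * w x ^+ 2)%R) \- (EFin \o (fun x => u x ^+ 2)%R))%E.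
    exact: integrableB.
  exact: eq_integrable.
suff: forall k, (k <= n)%N ->
    0 <= \int[mu]_(x in `]a, a + h * k%:R[) (8 * h ^+ 2 * w x ^+ 2 - u x ^+ 2).
  by apply.
elim=> [_|k IH kn]; first by rewrite mulr0 addr0 set_itvoo0 Rintegral_set0.
set F := fun x => 8 * h ^+ 2 * w x ^+ 2 - u x ^+ 2.
have le_h i j : (i <= j)%N -> a + h * i%:R <= a + h * j%:R.
  by move=> ij; rewrite lerD2l ler_pM2l// ler_nat.
have iFk j : (j <= n)%N -> mu.-integrable `]a, a + h * j%:R[ (EFin \o F).
  move=> jn; apply: integrableS iF => //; apply: subset_itvl.
  by rewrite bnd_simp le_h.
have := Rintegral_itvB (iFk _ kn) (x := a + h * k%:R).
rewrite !bnd_simp lerDl mulr_ge0 ?(ltW h0)// ltrD2l ltr_pM2l// ltr_nat ltnSn.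
move=> /(_ isT isT); rewrite -Rintegral_itv_bndo_bndc; last exact/iFk/ltnW.
move=> /eqP; rewrite subr_eq => /eqP ->; rewrite addr_ge0 ?IH 1?ltnW//.
rewrite (@eq_Rintegral _ _ _ mu _
  (fun x => 8 * h ^+ 2 * (q k)^`().[x] ^+ 2 - (q k).[x] ^+ 2)); last first.
  by move=> x; rewrite inE/= in_itv/= => kx; rewrite /F; have [-> ->] := uw _ _ kn kx.
pose P := (8 * h ^+ 2) *: (q k)^`() ^+ 2 - q k ^+ 2.
have iP : mu.-integrable `[a + h * k%:R, a + h * k.+1%:R]
   (EFin \o (fun x => 8 * h ^+ 2 * (q k)^`().[x] ^+ 2 - (q k).[x] ^+ 2)).
  apply: eq_integrable (integrable_horner P _ _) => // x _.
  by rewrite /P /= !hornerE.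
rewrite Rintegral_itv_bndo_bndc; last by apply: integrableS iP => //; exact: subset_itv_oo_cc.
rewrite Rintegral_itv_obnd_cbnd; last by apply: integrableS iP => //; exact: subset_itv_oc_cc.
have E : a + h * k.+1%:R = a + h * k%:R + h by rewrite -natr1; ring.
by rewrite E; apply: poincare_poly => //; rewrite -E; exact: q0.
Qed.

End poincare.

(** * Splines *)

(** The rank is at most [q < m], so the rows are linearly dependent. *)
Lemma exists_row_kernel (F : fieldType) m q (A : 'M[F]_(m, q)) : (q < m)%N ->
  exists2 d : 'rV_m, d != 0 & d *m A = 0.
Proof.
move=> qm; have : kermx A != 0.
  rewrite kermx_eq0 /row_free; apply/negP => /eqP rA.
  by have := rank_leq_col A; rewrite rA leqNgt qm.
by case/rowV0Pn => d /sub_kermxP dA d0; exists d.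
Qed.

Section splines.
Context {R : realType}.
Variables (a h : R) (m p : nat) (d : 'I_m -> R).
Hypotheses (h0 : 0 < h) (p_gt0 : (0 < p)%N).
Notation mu := (@lebesgue_measure R).
Notation b := (a + h * m.+1%:R).

Definition knot (j : nat) : R := a + h * j%:R.

Lemma knot_lt i j : (knot i < knot j) = (i < j)%N.
Proof. by rewrite /knot ltrD2l ltr_pM2l// ltr_nat. Qed.

Lemma knot_le i j : (knot i <= knot j) = (i <= j)%N.
Proof. by rewrite /knot lerD2l ler_pM2l// ler_nat. Qed.

Lemma knot0 : knot 0 = a. Proof. by rewrite /knot mulr0 addr0. Qed.

(* The k-th derivative of sum_i d_i (x - x_{i+1})_+^p. *)
Definition tspline k (x : R) : R :=
  \sum_(i < m) d i * ((p ^_ k)%:R * tpow (p - k) (knot i.+1) x).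

(** The polynomial on cell [j]: index [i] belongs to [knot i.+1], so exactly the powers with [i < j]
    have started. *)
Definition tspline_piece j : {poly R} :=
  \sum_(i < m | (i < j)%N) d i *: ('X - (knot i.+1)%:P) ^+ p.

Lemma is_weak_deriv_tspline k : (k <= p)%N ->
  is_weak_deriv `]a, b[ k (tspline 0) (tspline k).
Proof.
move=> kp.
rewrite [X in is_weak_deriv _ _ X](_ : _ =
    fun x => \sum_(i < m) d i * tpow p (knot i.+1) x); last first.
  by apply/funext => x; apply: eq_bigr => i _; rewrite ffactn0 mul1r subn0.
apply: is_weak_deriv_sum; first exact: itv_open.
move=> i; apply: is_weak_deriv_tpow => //.
  by rewrite -{1}knot0 knot_le.
by rewrite -/(knot _) knot_lt ltnS.
Qed.

Lemma measurable_tspline k (A : set R) : measurable A -> measurable_fun A (tspline k).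
Proof.
move=> mA; apply: measurable_sum => i; apply: measurable_funM => //.
by apply: measurable_funM => //; exact: measurable_tpow.
Qed.

Lemma tspline_bounded k : exists M, forall x, `]a, b[%classic x -> `|tspline k x| <= M.
Proof.
exists (\sum_(i < m) `|d i| * ((p ^_ k)%:R * (b - a) ^+ (p - k))) => x.
rewrite /= in_itv/= => /andP[_ xb].
apply: (le_trans (ler_norm_sum _ _ _)); apply: ler_sum => i _.
rewrite !normrM ler_wpM2l// ger0_norm// ler_wpM2l//.
apply: norm_tpow_le; [|exact: ltW|].
  by rewrite -{1}knot0 knot_le.
by rewrite -{1}knot0 -/(knot _) knot_le.
Qed.

(** The cell is closed on the right: by the strict truncation even the first derivative for [p = 1],
    a step function, takes there the value of the piece on its left. *)
Lemma tspline_pieceE k j x : (k <= 1)%N -> knot j < x <= knot j.+1 ->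
  tspline k x = (iter k deriv (tspline_piece j)).[x].
Proof.
move=> k1 /andP[jx xj].
have Tx q (i : nat) : tpow q (knot i.+1) x = if (i < j)%N then (x - knot i.+1) ^+ q else 0.
  rewrite /tpow; case: ltnP => ij.
    by rewrite (le_lt_trans _ jx)// knot_le.
  by rewrite ltNge (le_trans xj)// knot_le.
rewrite /tspline /tspline_piece; case: k k1 => [_|[_|//]] /=.
  rewrite horner_sum [RHS]big_mkcond/=; apply: eq_bigr => i _.
  rewrite Tx ffactn0 mul1r subn0; case: ifP => _; last by rewrite mulr0.
  by rewrite hornerZ horner_exp hornerXsubC.
rewrite raddf_sum horner_sum [RHS]big_mkcond/=; apply: eq_bigr => i _.
rewrite Tx ffactn1 subn1; case: ifP => _; last by rewrite !mulr0.
rewrite derivZ deriv_exp derivXsubC mul1r hornerZ hornerMn horner_exp.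
by rewrite hornerXsubC mulr_natl.
Qed.

(** [knot j] belongs to the preceding cell; the one power by which the two pieces differ is that at
    [knot j], which is 0 there because [p > 0]. *)
Lemma tspline_piece_knotl j : (tspline_piece j).[knot j] = tspline 0 (knot j).
Proof.
rewrite /tspline /tspline_piece horner_sum big_mkcond/=; apply: eq_bigr => i _.
rewrite ffactn0 mul1r subn0 /tpow knot_lt.
case: (ltngtP i.+1 j) => ij.
- by rewrite hornerZ horner_exp hornerXsubC.
- by rewrite mulr0.
- by rewrite ij hornerZ horner_exp hornerXsubC subrr expr0n gtn_eqF ?mulr0.
Qed.

Lemma tspline_le_knot1 k x : x <= knot 1 -> tspline k x = 0.
Proof.
move=> x1; rewrite /tspline big1// => i _; rewrite /tpow ltNge.
by rewrite (le_trans x1) ?knot_le// !mulr0.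
Qed.

Lemma continuous_tspline k : (k < p)%N -> continuous (tspline k).
Proof.
move=> kp; rewrite /tspline -fct_sumE; elim/big_ind: _ => [x|f g cf cg x|i _ x].
- exact: (@cvg_cst R).
- by apply: cvgD; [exact: cf|exact: cg].
apply: cvgM; first exact: (@cvg_cst R).
apply: cvgM; first exact: (@cvg_cst R).
(* The positive part is [(y + |y|) / 2]; the power of its value 0 is again 0 because [p - k > 0]. *)
rewrite (_ : tpow _ _ =
  fun x => ((x - knot i.+1 + `|x - knot i.+1|) / 2) ^+ (p - k)); last first.
  apply/funext => y; rewrite /tpow; case: ltP => ky.
    by rewrite ger0_norm ?subr_ge0 1?ltW//; congr (_ ^+ _); field.
  by rewrite ler0_norm ?subr_le0// subrr mul0r expr0n gtn_eqF// subn_gt0.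
apply: (@continuous_comp _ _ _ (fun y => (y - knot i.+1 + `|y - knot i.+1|) / 2)
  (fun y => y ^+ (p - k))); last exact: exprn_continuous.
apply: cvgM; last exact: (@cvg_cst R).
have cs : {for x, continuous (fun x => x - knot i.+1)}.
  by apply: cvgB; [exact: cvg_id|exact: (@cvg_cst R)].
by apply: cvgD => //; apply: cvg_norm.
Qed.

Lemma Sobolev_tspline : Sobolev `]a, b[ p (tspline 0).
Proof.
have L2k k : L2 `]a, b[ (tspline k).
  have [M tM] := tspline_bounded k.
  apply: (L2_bounded _ _ M) => //.
    by rewrite /= lebesgue_measure_itv/=; case: ifPn; rewrite ltry.
  exact: measurable_tspline.
split => // k kp; exists (tspline k); split => //.
exact: is_weak_deriv_tspline.
Qed.

Lemma spline_tspline : grid_count a b h = m.+1 -> spline a b p h (tspline 0).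
Proof.
move=> gc; split; first exact: Sobolev_tspline.
rewrite gc => j jm; exists (tspline_piece j); split.
  rewrite /tspline_piece; apply: (leq_trans (size_sum _ _ _)); apply/bigmax_leqP => i _.
  by apply: (leq_trans (size_scale_leq _ _)); rewrite size_exp_XsubC.
move=> x; rewrite in_itv/= => jx; exact: tspline_pieceE.
Qed.

(** Linear independence, by strong induction: at the midpoint of the cell after [knot i.+1], the
    earlier coefficients are already 0 and the later powers have not started, which isolates
    [d i]. *)
Lemma tspline_eq0 : (forall x, x \in `]a, b[ -> tspline 0 x = 0) -> forall i, d i = 0.
Proof.
move=> t0 [i]; elim/ltn_ind: i => i IH im.
have /andP[ki ki'] : knot i.+1 < knot i.+1 + h / 2 < knot i.+2.
  rewrite ltrDl divr_gt0//= /knot -[i.+2%:R]natr1 mulrDr mulr1 addrA ltrD2l.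
  by rewrite ltr_pdivrMr// ltr_pMr// ltr1n.
have := t0 (knot i.+1 + h / 2).
rewrite in_itv/= -{1}knot0 (lt_trans _ ki) ?knot_lt//= (lt_le_trans ki') ?knot_le//.
move=> /(_ isT); rewrite /tspline (bigD1 (Ordinal im))//= big1 ?addr0.
  rewrite /tpow ki ffactn0 mul1r subn0 addrC addKr => /eqP.
  by rewrite mulf_eq0 expf_eq0 [h / 2 == 0]gt_eqF ?divr_gt0// andbF orbF => /eqP.
move=> j ji; have [jli|ilj] := ltnP j i.
  have -> : j = Ordinal (ltn_trans jli im) by exact/val_inj.
  by rewrite IH// mul0r.
rewrite /tpow ltNge (le_trans (ltW ki')) ?mulr0 ?mul0r//.
by rewrite knot_le !ltnS ltn_neqAle ilj andbT eq_sym.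
Qed.

(** Of two consecutive knots one has an even index, so every cell has an endpoint where the spline
    is 0; at [knot 0] this is automatic. *)
Lemma poincare_tspline :
  (forall t, (0 < t)%N -> (2 * t <= m.+1)%N -> tspline 0 (knot (2 * t)) = 0) ->
  \int[mu]_(x in `]a, b[) (tspline 0 x ^+ 2) <=
  8 * h ^+ 2 * \int[mu]_(x in `]a, b[) (tspline 1 x ^+ 2).
Proof.
move=> t0.
have isqr k : mu.-integrable `]a, b[ (EFin \o (fun x => tspline k x ^+ 2)).
  have [M tM] := tspline_bounded k.
  apply: (integrable_sqr_bounded _ _ M) => //.
    by rewrite /= lebesgue_measure_itv/=; case: ifPn; rewrite ltry.
  exact: measurable_tspline.
apply: (poincare_piecewise _ _ _ _ _ tspline_piece) => //.
- move=> j jm; have [oj|ej] := boolP (odd j).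
    right; rewrite -/(knot _) -(tspline_pieceE 0)//; last first.
      by rewrite knot_lt ltnS leqnn lexx.
    by rewrite (_ : j.+1 = 2 * j.+1./2)%N ?t0//; lia.
  left; rewrite -/(knot _) tspline_piece_knotl.
  case: j jm ej => [|j] jm ej; first by rewrite tspline_le_knot1// knot_le.
  by rewrite (_ : j.+1 = 2 * j.+1./2)%N ?t0//; lia.
- move=> j x jm /andP[jx xj]; have jxj : knot j < x <= knot j.+1 by rewrite jx ltW.
  by split; [rewrite (tspline_pieceE 0 j)|rewrite (tspline_pieceE 1 j)].
Qed.

End splines.

(** * Choice of the coefficients and the final estimate *)

Theorem corollary3 (R : realType) (a b : R) (ab : a < b) (h : R)
    (hgrid : grid_size a b h) (p : nat) (p_gt0 : (0 < p)%N)
    (hp : 2 * h * p%:R < b - a) :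
  exists u : R -> R,
    [/\ spline_odd0 a b p h u,
        ~ (exists c : R, forall x, x \in `]a, b[ -> u x = c) &
        (2 * Num.sqrt 2)^-1 * h^-1 * L2norm `]a, b[ u
          <= Sobolev_seminorm `]a, b[ 1 u].
Proof.
have [h0 [n [n_gt0 nE]]] := hgrid.
have gc : grid_count a b h = n by rewrite /grid_count nE natrK.
have bE : b = a + h * n%:R by rewrite -nE mulrA mulfV ?gt_eqF// mul1r addrC subrK.
have pn : (2 * p < n)%N.
  have : h * (2 * p%:R) < h * n%:R by move: hp; rewrite bE; lra.
  by rewrite ltr_pM2l// -natrM ltr_nat.
case: n n_gt0 nE gc bE pn => [//|m] _ nE gc bE pn; subst b.
(* The first p - 1 columns are for the derivatives at b (up to a factor), the
   others for the values at the even knots. *)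
pose A : 'M[R]_(m, p.-1 + m.+1./2) := \matrix_(i, k)
  if (k < p.-1)%N then tpow (p - k.+1) (knot a h i.+1) (knot a h m.+1)
  else tpow p (knot a h i.+1) (knot a h (2 * (k - p.-1).+1)).
(* Here [2p <= m], so the number of columns is at most [p - 1 + (m + 1)/2 <= m - 1/2], hence less
   than [m]. *)
have [d d0 dA] : exists2 d : 'rV_m, d != 0 & d *m A = 0.
  by apply: exists_row_kernel; lia.
pose t := tspline a h m p (d 0).
have dA0 (k : 'I_(p.-1 + m.+1./2)) : \sum_i d 0 i * A i k = 0.
  by move/matrixP : dA => /(_ 0 k); rewrite !mxE.
have tb k : (0 < k < p)%N -> t k (knot a h m.+1) = 0.
  move=> /andP[k_gt0 kp]; have kq : (k.-1 < p.-1 + m.+1./2)%N by lia.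
  (* Column [k - 1] holds the [k]-th derivatives at the right endpoint without the common factor
     [p ^_ k], which is pulled out first. *)
  rewrite /t /tspline; under eq_bigr do rewrite mulrCA.
  rewrite -mulr_sumr -[RHS](mulr0 (p ^_ k)%:R).
  congr (_ * _); rewrite -[RHS](dA0 (Ordinal kq)).
  apply: eq_bigr => i _; rewrite mxE/= ifT ?prednK//; lia.
have t0 j : (0 < j)%N -> (2 * j <= m.+1)%N -> t 0%N (knot a h (2 * j)) = 0.
  move=> j_gt0 jm; have kq : (p.-1 + j.-1 < p.-1 + m.+1./2)%N by lia.
  rewrite -[RHS](dA0 (Ordinal kq)); apply: eq_bigr => i _.
  by rewrite mxE/= ifF ?addKn ?prednK// ?ffactn0 ?mul1r ?subn0//; lia.
exists (t 0%N); split.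
- split; first exact: spline_tspline.
  move=> l lp; split; exists (t (2 * l).+1); split.
  + exact/is_weak_deriv_tspline/ltnW.
  + by apply: continuous_subspaceT; exact: continuous_tspline.
  + by apply: tspline_le_knot1 => //; rewrite -{1}(knot0 a h) knot_le.
  + exact/is_weak_deriv_tspline/ltnW.
  + by apply: continuous_subspaceT; exact: continuous_tspline.
  + exact: tb.
(* The spline is 0 at the midpoint of the first cell, so a constant value would be 0, and linear
   independence would give [d = 0]. *)
- move=> [c tc]; have c0 : c = 0.
    rewrite -(tc (a + h / 2)); last first.
      rewrite in_itv/=; apply/andP; split; first by lra.
      have : h * 1 <= h * m.+1%:R by rewrite ler_pM2l// ler1n.
      by lra.
    by apply: tspline_le_knot1 => //; rewrite /knot; lra.
  move/eqP : d0; apply; apply/rowP => i; rewrite mxE.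
  by apply: (tspline_eq0 a h m p (d 0)) => // x xab; rewrite -/t tc.
- have wt : is_weak_deriv `]a, a + h * m.+1%:R[ 1 (t 0%N) (t 1%N).
    exact: is_weak_deriv_tspline.
  (* Since [t 1] is a weak derivative, [xget] picks a genuine one rather than its default. *)
  have wv : is_weak_deriv `]a, a + h * m.+1%:R[ 1 (t 0%N)
      (weak_deriv `]a, a + h * m.+1%:R[ 1 (t 0%N)).
    exact: xgetI wt.
  rewrite /Sobolev_seminorm [leRHS](L2norm_ae _ _ (t 1%N))//; first last.
  + have := weak_deriv_ae_eq _ _ _ _ _ _ wv wt.
    apply: (@filterS _ _ (ae_filter_ringOfSetsType _)) => x vt xab.
    by apply: vt; move: xab; rewrite /= in_itv.
  + by case: wt => _ [].
  + by case: wv => _ [].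
  rewrite !L2normE -invfM ler_pdivrMl; last by rewrite !mulr_gt0// sqrtr_gt0.
  have := poincare_tspline a h m p (d 0) h0 p_gt0 t0.
  move=> /ler_wsqrtr /le_trans; apply.
  rewrite sqrtrM; last by rewrite mulr_ge0// sqr_ge0.
  rewrite sqrtrM// sqrtr_sqr (gtr0_norm h0).
  (* The constant: [sqrt (8 h^2) = 2 sqrt 2 h]. *)
  rewrite (_ : 8 = 2 ^+ 2 * 2); last by ring.
  by rewrite sqrtrM ?sqr_ge0// sqrtr_sqr ger0_norm.
Qed.
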